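(* Let $a_n$ be the number of vertices of the $n^{th}$ multiplihedron $\mathcal{J}(n)$ for $n\ge 1$, equivalently the number of painted binary trees with $n$ leaves, and set $a_0=0$. Then for all $n\ge 1$ $$a_n = C(n-1)+\sum_{i=1}^{n-1}a_i\,a_{n-i},$$ where $C(m)$ denotes the $m$-th Catalan number, so that $C(n-1)$ is the number of (unpainted) planar binary trees with $n$ leaves.
   Context: All trees are planar rooted trees. Vertices other than the root and the leaves are called nodes; the edge at the root is the root edge, edges at leaves are leaf edges; the branches of a node are its edges other than the one leading toward the root. A painted binary tree is such a tree with every edge either painted or unpainted, such that all leaf edges are unpainted, the root edge is painted, and every node is of one of three types: (1) trivalent with all its edges unpainted; (2) trivalent with all its edges painted; (3) bivalent, with the edge toward the root painted and its single branch unpainted. The $n^{th}$ multiplihedron $\mathcal{J}(n)$ is an $(n-1)$-dimensional complex whose vertices are in bijection with the painted binary trees with $n$ leaves. *)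

(* Defs.v *)
From HB Require Import structures.
From mathcomp Require Import all_boot finmap.
From mathcomp Require Import boolp classical_sets functions cardinality.

Set Implicit Arguments.
Unset Strict Implicit.
Unset Printing Implicit Defensive.

Local Open Scope nat_scope.
Local Open Scope classical_set_scope.

(* [Vertex p bs] is a vertex other than the root, together with the edge
   leading from it toward the root: [p] tells whether that edge is painted, and
   [bs] lists, from left to right, the vertices at the far ends of its branches.
   A planar rooted tree (its root being incident to the root edge only) is
   represented by the vertex at the far end of its root edge. *)
Inductive ptree : Type := Vertex (p : bool) (bs : seq ptree).

Definition painted (v : ptree) : bool := let: Vertex p _ := v in p.

Definition branches (v : ptree) : seq ptree := let: Vertex _ bs := v in bs.

Fixpoint ptree_encode (t : ptree) : GenTree.tree void :=
  let: Vertex p bs := t in GenTree.Node p (map ptree_encode bs).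

Fixpoint ptree_decode (g : GenTree.tree void) : ptree :=
  if g is GenTree.Node k gs then Vertex (k == 1) (map ptree_decode gs)
  else Vertex false [::].

Fixpoint ptree_encodeK (t : ptree) : ptree_decode (ptree_encode t) = t.
Proof.
case: t => p bs /=; congr Vertex; first by case: p.
by elim: bs => //= b bs ->; rewrite ptree_encodeK.
Qed.

HB.instance Definition _ := Countable.copy ptree (can_type ptree_encodeK).

(* One entry for each vertex of [t] other than the root. *)
Fixpoint vertices (t : ptree) : seq ptree :=
  let: Vertex _ bs := t in t :: flatten (map vertices bs).

Definition is_leaf (v : ptree) : bool := branches v == [::].

Definition nb_leaves (t : ptree) : nat := count is_leaf (vertices t).

(* The paint of all edges at [v], the one toward the root coming first. *)
Definition edges_at (v : ptree) : seq bool := painted v :: map painted (branches v).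

Definition node_unpainted (v : ptree) : bool :=
  (size (edges_at v) == 3) && all negb (edges_at v).

Definition node_painted (v : ptree) : bool :=
  (size (edges_at v) == 3) && all id (edges_at v).

Definition node_transition (v : ptree) : bool := edges_at v == [:: true; false].

Definition painted_binary (t : ptree) : bool :=
  painted t &&
  all (fun v => if is_leaf v then ~~ painted v
                else [|| node_unpainted v, node_painted v | node_transition v])
      (vertices t).

(* Unpainted planar binary trees are the trees all of whose edges are unpainted
   and all of whose nodes are trivalent. *)
Definition unpainted_binary (t : ptree) : bool :=
  all (fun v => if is_leaf v then ~~ painted v else node_unpainted v)
      (vertices t).

Definition painted_binary_trees (n : nat) : set ptree :=
  [set t | painted_binary t /\ nb_leaves t = n].

Definition unpainted_binary_trees (n : nat) : set ptree :=
  [set t | unpainted_binary t /\ nb_leaves t = n].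

Definition catalan (m : nat) : nat := 'C(m.*2, m) %/ m.+1.

(* [fset_set] is junk on infinite sets; the lemmas below show that the sets of
   trees being counted are finite. *)

Fixpoint height (t : ptree) : nat :=
  let: Vertex _ bs := t in (foldr maxn 0 (map height bs)).+1.

Fixpoint trees_upto (k : nat) : seq ptree :=
  if k is j.+1 then
    let T := trees_upto j in
    let B := [::] :: [seq [:: x] | x <- T] ++ [seq [:: x; y] | x <- T, y <- T] in
    map (Vertex true) B ++ map (Vertex false) B
  else [::].

Definition painted_types (t : ptree) : bool :=
  all (fun v => if is_leaf v then ~~ painted v
                else [|| node_unpainted v, node_painted v | node_transition v])
      (vertices t).

Lemma mem_trees_upto k t :
  height t <= k -> painted_types t -> t \in trees_upto k.
Proof.
elim: k t => [|k IHk] [p bs] //; rewrite [height _]/= ltnS => hb tb.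
have memB (B : seq (seq ptree)) :
    bs \in B -> Vertex p bs \in map (Vertex true) B ++ map (Vertex false) B.
  by move=> Bbs; rewrite mem_cat; case: p {tb} => /=; rewrite map_f ?orbT.
apply: memB; rewrite inE mem_cat; case: bs hb tb => [|x [|y [|z bs]]] //=.
- rewrite maxn0 /painted_types /= => hx /andP[_]; rewrite cats0 => tx.
  by apply/orP; left; apply: map_f; apply: IHk.
- rewrite !geq_max /painted_types /= => /and3P[hx hy _] /andP[_].
  rewrite cats0 all_cat => /andP[tx ty]; apply/orP; right.
  by apply/allpairsP; exists (x, y); split=> //=; apply: IHk.
- rewrite /painted_types /= /node_unpainted /node_painted /node_transition.
  by rewrite /edges_at /= !eqseq_cons !andbF.
Qed.

Fixpoint nb_leaves_gt0 (t : ptree) : 0 < nb_leaves t.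
Proof.
case: t => p [|x bs]; [exact: ltn0Sn | rewrite /nb_leaves /= add0n count_cat].
by apply: ltn_addr; apply: nb_leaves_gt0.
Qed.

Lemma painted_types_height t :
  painted_types t -> height t <= nb_leaves t + painted t.
Proof.
have [k] := ubnP (height t); elim: k t => // k IHk [p bs].
rewrite [height _]/= ltnS.
case: bs => [|x [|y [|z bs]]] //=.
- rewrite maxn0 /painted_types /= cats0 => hk /andP[].
  rewrite /node_unpainted /node_painted /node_transition /edges_at /=.
  rewrite !eqseq_cons andbT => /andP[/eqP-> /eqP xu] tx.
  have := IHk x hk tx; rewrite xu addn0 /nb_leaves /= cats0 add0n addn1.
  by rewrite ltnS.
- rewrite maxn0 /painted_types /nb_leaves /= cats0 add0n all_cat count_cat.
  move=> hk /and3P[pt tx ty]; move: hk.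
  rewrite -[count _ (vertices x)]/(nb_leaves x).
  rewrite -[count _ (vertices y)]/(nb_leaves y) gtn_max => /andP[kx ky].
  have hx := IHk x kx tx; have hy := IHk y ky ty.
  have [px py] : painted x = p /\ painted y = p.
    move: pt; rewrite /node_unpainted /node_painted /node_transition /edges_at /=.
    by case: p (painted x) (painted y) => [] [] [].
  rewrite px in hx; rewrite py in hy.
  rewrite gtn_max; apply/andP; split.
    apply: leq_ltn_trans hx _.
    by rewrite ltn_add2r -[X in X < _]addn0 ltn_add2l nb_leaves_gt0.
  apply: leq_ltn_trans hy _.
  by rewrite ltn_add2r -[X in X < _]add0n ltn_add2r nb_leaves_gt0.
- rewrite /painted_types /= /node_unpainted /node_painted /node_transition.
  by rewrite /edges_at /= !eqseq_cons !andbF.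
Qed.

Lemma unpainted_binary_types t : unpainted_binary t -> painted_types t.
Proof. by apply: sub_all => v; case: ifP => // _ ->. Qed.

Lemma finite_painted_types (A : set ptree) (n : nat) :
  (forall t, A t -> painted_types t /\ nb_leaves t = n) -> finite_set A.
Proof.
move=> At; apply: sub_finite_set (finite_seq (trees_upto n.+1)) => t /At[tt tn] /=.
suff : t \in trees_upto n.+1 by [].
apply: mem_trees_upto (tt); apply: leq_trans (painted_types_height tt) _.
by rewrite tn -addn1 leq_add2l leq_b1.
Qed.

Lemma finite_painted_binary_trees n : finite_set (painted_binary_trees n).
Proof. by apply: (@finite_painted_types _ n) => t [/andP[]]. Qed.

Lemma finite_unpainted_binary_trees n : finite_set (unpainted_binary_trees n).
Proof.
by apply: (@finite_painted_types _ n) => t [/unpainted_binary_types].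
Qed.

(* Main.v *)
Require Import Defs.
From mathcomp Require Import all_boot all_algebra finmap ring.
From mathcomp Require Import boolp classical_sets functions cardinality.

(** The vertex at the far end of the root edge of a painted binary tree cannot
    be a leaf, the root edge being painted.  If it is the bivalent node, its
    single branch is unpainted; no type of node lets paint reappear farther from
    the root, so that branch carries an arbitrary unpainted binary tree, which
    has all the leaves.  If it is trivalent, it is painted, and its two branches
    carry arbitrary painted binary trees that share the leaves
    ([painted_binaryE]).
    Counting the two cases gives [card_painted_enum]:
      #P(n) = #U(n) + \sum_i #P(i) #P(n - i).

    The same cut applied to an unpainted binary tree ([unpainted_binaryE]) gives
    Segner's recurrence for #U(n), the single leaf now being the exceptional
    case.  What remains is that the closed form of the Catalan numbers obeys
    Segner's recurrence ([catalan_convolution]), whence #U(n) = C(n - 1) by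
    induction.  That is proved by telescoping: each product C(i) C(m - i) is the
    difference of two consecutive values of an explicit multiple of the product
    of two central binomial coefficients.

    Both counts come from one lemma, [card_add_graftings], about families of
    trees graded by the number of leaves. *)

Local Open Scope nat_scope.
Local Open Scope classical_set_scope.

(** * The Catalan recurrence *)

(** The quotient defining [catalan] is exact: m * 'C(2m, m) =
    (m + 1) * 'C(2m, m + 1), and m + 1 is coprime to m. *)
Lemma catalanE m : m.+1 * catalan m = 'C(m.*2, m).
Proof.
rewrite mulnC; apply: divnK.
rewrite -(@Gauss_dvdr m.+1 m) ?coprimeSn //.
have := mul_bin_left m.*2 m; rewrite -addnn addnK => <-.
exact: dvdn_mulr.
Qed.

Lemma central_bin_rec m :
  m.+1 * 'C(m.+1.*2, m.+1) = (m.*2.+1).*2 * 'C(m.*2, m).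
Proof.
have down := mul_bin_down m.*2.+1 m; have diag := mul_bin_diag m.+1.*2 m.
rewrite doubleS /= in diag.
have sub2 : m.*2.+1 - m = m.+1 by rewrite -addnn subSn ?leq_addr// addnK.
rewrite sub2 /= in down.
rewrite doubleS -diag -doubleS -[m.+1.*2]mul2n -[m.*2.+1.*2]mul2n.
by rewrite -!mulnA down.
Qed.

Section CatalanConvolution.
Import GRing.Theory Num.Theory.
Local Open Scope ring_scope.

(** Solved for the larger coefficient, the recurrence lets every central
    binomial coefficient at a successor be eliminated by rewriting. *)
Lemma central_bin_recF (F : numFieldType) m :
  'C(m.+1.*2, m.+1)%:R
  = 2 * (2 * m%:R + 1) / (m%:R + 1) * 'C(m.*2, m)%:R :> F.
Proof.
have m1_neq0 : m%:R + 1 != 0 :> F by rewrite natr1 pnatr_eq0.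
have := congr1 (GRing.natmul (1 : F)) (central_bin_rec m).
rewrite -!mul2n !natrM -!natr1 natrM => rec.
by apply: (mulfI m1_neq0); rewrite rec; field.
Qed.

Lemma catalanF (F : numFieldType) m :
  (catalan m)%:R = 'C(m.*2, m)%:R / (m%:R + 1) :> F.
Proof.
by rewrite -catalanE natrM -natr1 mulrC mulKf // natr1 pnatr_eq0.
Qed.

(** Gosper summation.  Up to a factor that depends on m only, the summand is the
    difference in j of 'C(2j, j) * 'C(2(m+1-j), m+1-j) * (2j - (m+1)).  This
    primitive is antisymmetric under j -> m + 1 - j, so its two boundary values
    are opposite, and the sum is twice the upper one.  The omitted factor is a
    fraction, hence the field. *)
Lemma catalan_convolutionF (F : numFieldType) m :
  (catalan m.+1)%:R = \sum_(0 <= i < m.+1) (catalan i)%:R * (catalan (m - i))%:R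
    :> F.
Proof.
pose q k : F := 'C(k.*2, k)%:R.
pose G j := q j * q (m.+1 - j)%N * (2 * j%:R - m.+1%:R)
            / (2 * (m%:R + 1) * (m%:R + 2)).
symmetry; rewrite (telescope_sumr_eq G) => [||i /andP[_]] //; last first.
  rewrite ltnS => le_im; rewrite !catalanF /G /q subSS subSn //.
  rewrite -(natr1 m) -[in X in _ = X](subnKC le_im).
  (* In terms of i and k = m - i no truncated subtraction is left, and both
     sides are rational multiples of 'C(2i, i) * 'C(2k, k). *)
  move: (m - i)%N => k; rewrite addKn !central_bin_recF -(natr1 i) !natrD.
  field.
  by rewrite -!natrD !natr1 !pnatr_eq0 addn2.
rewrite catalanF /G /q subnn subn0 bin0 -!(natr1 m).
field.
by rewrite !natr1 !pnatr_eq0.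
Qed.

Lemma catalan_convolution m :
  catalan m.+1 = (\sum_(0 <= i < m.+1) catalan i * catalan (m - i))%N.
Proof.
apply/eqP; rewrite -(eqr_nat rat) catalan_convolutionF natr_sum.
by apply/eqP/eq_bigr => i _; rewrite natrM.
Qed.

End CatalanConvolution.

(** * Grafting two trees on a new node *)

(** The range of i leaves out 0 and n: each side of the new node carries a leaf.
    A sequence rather than a set, so that its size is the convolution sum and
    absence of repetitions is a separate statement. *)
Definition graftings (p : bool) (A : nat -> seq ptree) (n : nat) : seq ptree :=
  [seq Vertex p [:: xy.1; xy.2]
     | i <- index_iota 1 n, xy <- [seq (x, y) | x <- A i, y <- A (n - i)]].

Lemma size_graftings p A n :
  size (graftings p A n) = \sum_(1 <= i < n) size (A i) * size (A (n - i)).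
Proof.
rewrite size_allpairs_dep sumnE big_map; apply: eq_bigr => i _.
by rewrite size_allpairs.
Qed.

Lemma mem_graftings p (A : nat -> seq ptree) n t :
  reflect (exists x y i, [/\ t = Vertex p [:: x; y], 0 < i < n, x \in A i
                          & y \in A (n - i)])
          (t \in graftings p A n).
Proof.
apply: (iffP allpairsPdep) => [[i [_ [+ /allpairsP[[x y] /= [xA yA ->]] ->]]]|].
  by rewrite mem_index_iota => ni; exists x, y, i.
move=> [x [y [i [-> ni xA yA]]]]; exists i, (x, y).
by rewrite mem_index_iota; split=> //; apply/allpairsP; exists (x, y).
Qed.

(** A grafting determines i as the number of leaves of its left branch, so the
    parts with different i do not overlap. *)
Lemma uniq_graftings p (A : nat -> seq ptree) n :
  (forall i, uniq (A i)) -> (forall i t, t \in A i -> nb_leaves t = i) ->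
  uniq (graftings p A n).
Proof.
move=> uA leavesA; apply: allpairs_uniq_dep => [|i _|]; first exact: iota_uniq.
  by apply: allpairs_uniq => // -[x y] [x' y'].
move=> u v /allpairsPdep[i [_ [_ /allpairsP[[x y] /= [xi _ ->]] ->]]].
move=> /allpairsPdep[j [_ [_ /allpairsP[[x' y'] /= [xj _ ->]] ->]]].
by case=> xx' yy'; rewrite /= -(leavesA _ _ xi) -(leavesA _ _ xj) xx' yy'.
Qed.

Lemma nb_leaves1 p x : nb_leaves (Vertex p [:: x]) = nb_leaves x.
Proof. by rewrite /nb_leaves /= cats0. Qed.

Lemma nb_leaves2 p x y :
  nb_leaves (Vertex p [:: x; y]) = nb_leaves x + nb_leaves y.
Proof. by rewrite /nb_leaves /= cats0 count_cat. Qed.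

(** * Decomposing a tree at the top of its root edge *)

(** [node_unpainted] constrains the colours of the branches as well, but this is
    already forced by the condition on the vertices at their far ends. *)
Lemma unpainted_binaryE p bs :
  unpainted_binary (Vertex p bs) =
  ~~ p && match bs with
          | [::] => true
          | [:: x; y] => unpainted_binary x && unpainted_binary y
          | _ => false
          end.
Proof.
rewrite /unpainted_binary /=.
have rootP v : unpainted_binary v -> ~~ painted v.
  case: v => q [|x cs]; rewrite /unpainted_binary //= => /andP[] //.
  by rewrite /node_unpainted /= => /andP[_ /andP[]].
case: bs => [|x [|y [|z bs]]] /=; rewrite /node_unpainted ?andbT ?andbF //.
rewrite /= cats0 all_cat -!/(unpainted_binary _) !andbA andbT.
have := rootP x; have := rootP y.
case: (unpainted_binary x) => [ry /(_ isT) ->|_ _]; last by rewrite !andbF.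
case: (unpainted_binary y) ry => [/(_ isT) ->|_]; last by rewrite !andbF.
by rewrite !andbT.
Qed.

Lemma painted_typesE p bs :
  painted_types (Vertex p bs) =
  match bs with
  | [::] => ~~ p
  | [:: x] => [&& p, ~~ painted x & painted_types x]
  | [:: x; y] => [&& painted x == p, painted y == p, painted_types x
                   & painted_types y]
  | _ => false
  end.
Proof.
rewrite /painted_types /=.
case: bs => [|x [|y [|z bs]]] /=;
  rewrite /node_unpainted /node_painted /node_transition /edges_at /=
          ?eqseq_cons ?cats0 ?all_cat ?andbT ?andbF //.
  by case: p (painted x) => [] [].
by case: p (painted x) (painted y) => [] [] [] /=; rewrite ?andbF.
Qed.

(** No node type has a painted branch when its edge toward the root is unpainted,
    so an unpainted root edge makes the whole tree unpainted. *)
Fixpoint unpainted_binary_painted_types t :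
  unpainted_binary t = ~~ painted t && painted_types t.
Proof.
case: t => p [|x [|y [|z bs]]]; rewrite unpainted_binaryE painted_typesE /=.
- by rewrite andbT andbb.
- by case: p.
- rewrite !unpainted_binary_painted_types.
  by case: p (painted x) (painted y) => [] [] [] /=; rewrite ?andbF.
- by [].
Qed.

Lemma painted_binaryE p bs :
  painted_binary (Vertex p bs) =
  p && match bs with
       | [:: x] => unpainted_binary x
       | [:: x; y] => painted_binary x && painted_binary y
       | _ => false
       end.
Proof.
rewrite /painted_binary -!/(painted_types _) painted_typesE.
case: p => //; case: bs => [|x [|y [|z bs]]] //=.
  by rewrite unpainted_binary_painted_types.
by rewrite -!/(painted_types _) !eqb_id !andbA; congr (_ && _); rewrite andbAC.
Qed.

(** * Counting the two kinds of trees *)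

Definition unpainted_enum n := fset_set (unpainted_binary_trees n).
Definition painted_enum n := fset_set (painted_binary_trees n).

Lemma mem_unpainted_enum n t :
  (t \in unpainted_enum n) = unpainted_binary t && (nb_leaves t == n).
Proof.
rewrite in_fset_set; last exact: finite_unpainted_binary_trees.
by apply/idP/andP; rewrite inE /= => -[? /eqP ?].
Qed.

Lemma mem_painted_enum n t :
  (t \in painted_enum n) = painted_binary t && (nb_leaves t == n).
Proof.
rewrite in_fset_set; last exact: finite_painted_binary_trees.
by apply/idP/andP; rewrite inE /= => -[? /eqP ?].
Qed.

(** When [A] sorts the trees satisfying [P] by their number of leaves, the index
    i is recovered from the left branch and disappears from the membership
    condition. *)
Lemma mem_graftings_by_leaves p (P : pred ptree) (A : nat -> seq ptree) n x y :
  (forall i t, (t \in A i) = P t && (nb_leaves t == i)) ->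
  (Vertex p [:: x; y] \in graftings p A n) =
  [&& P x, P y & nb_leaves x + nb_leaves y == n].
Proof.
move=> memA; apply/mem_graftings/and3P
  => [[x' [y' [i [[-> ->]]]]]|[Px Py /eqP xy]].
  case/andP=> _ lt_in; rewrite !memA => /andP[Px /eqP lx] /andP[Py /eqP ly].
  by split=> //; rewrite lx ly subnKC // ltnW.
exists x, y, (nb_leaves x).
rewrite !memA Px Py -xy addKn !eqxx nb_leaves_gt0.
by rewrite -[X in X < _]addn0 ltn_add2l nb_leaves_gt0.
Qed.

Lemma mem_graftingsF p q (A : nat -> seq ptree) n bs :
  (p != q) || (size bs != 2) -> (Vertex q bs \in graftings p A n) = false.
Proof.
move=> neq; apply/negP => /mem_graftings[x [y [i [[eq_p eq_bs] _ _ _]]]].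
by rewrite eq_p eq_bs eqxx in neq.
Qed.

(** The counting step common to both kinds of trees: [s] holds the trees whose
    vertex nearest to the root does not have two branches, which keeps them
    apart from the graftings. *)
Lemma card_add_graftings p (A : nat -> {fset ptree}) (s : seq ptree) n :
  (forall i t, t \in A i -> nb_leaves t = i) ->
  uniq s -> all (fun t => size (branches t) != 2) s ->
  A n =i s ++ graftings p A n ->
  #|` A n| = size s + \sum_(1 <= i < n) #|` A i| * #|` A (n - i)|.
Proof.
move=> leavesA us s_no2 An.
rewrite -(size_graftings p (fun i => A i)) -size_cat.
apply/perm_size/uniq_perm => //.
have uG : uniq (graftings p A n)
  by apply: uniq_graftings => // i; exact: fset_uniq.
rewrite cat_uniq us uG andbT /=.
apply/hasPn => t /mem_graftings[x [y [i [-> _ _ _]]]].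
by apply/negP => /(allP s_no2).
Qed.

Lemma card_unpainted_enum n :
  #|` unpainted_enum n| =
  (n == 1)
  + \sum_(1 <= i < n) #|` unpainted_enum i| * #|` unpainted_enum (n - i)|.
Proof.
pose s := if n == 1 then [:: Vertex false [::]] else [::].
have -> : (n == 1 : nat) = size s by rewrite /s; case: eqP.
apply: (card_add_graftings false) => [i t|||[p bs]]; try by rewrite /s; case: eqP.
  by rewrite mem_unpainted_enum => /andP[_ /eqP].
have memU := mem_unpainted_enum.
have sE q cs : (Vertex q cs \in s) = [&& ~~ q, nilp cs & n == 1].
  rewrite /s; case: eqP => _; rewrite ?andbF // inE andbT.
  by apply/eqP/andP => [[-> ->]|[/negPf-> /nilP->]].
rewrite mem_cat memU unpainted_binaryE sE.
case: p bs => [] [|x [|y [|z bs]]]; try by rewrite mem_graftingsF.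
- by rewrite mem_graftingsF // orbF eq_sym.
- by rewrite (mem_graftings_by_leaves _ _ _ _ _ _ memU) nb_leaves2 -!andbA.
Qed.

Lemma card_painted_enum n :
  #|` painted_enum n| =
  #|` unpainted_enum n|
  + \sum_(1 <= i < n) #|` painted_enum i| * #|` painted_enum (n - i)|.
Proof.
pose s := [seq Vertex true [:: x] | x <- unpainted_enum n].
have -> : #|` unpainted_enum n| = size s by rewrite size_map.
have memP := mem_painted_enum.
apply: (card_add_graftings true) => [i t|||[p bs]].
- by rewrite memP => /andP[_ /eqP].
- by rewrite map_inj_uniq ?fset_uniq // => x y [].
- by rewrite all_map; apply/allP.
rewrite mem_cat memP painted_binaryE.
have inj_true1 : injective (fun x => Vertex true [:: x]) by move=> x y [].
have sF q cs : ~~ q || (size cs != 1) -> (Vertex q cs \in s) = false.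
  by move=> neq; apply/negP => /mapP[x _ [eq_q eq_cs]]; rewrite eq_q eq_cs in neq.
case: p bs => [] [|x [|y [|z bs]]]; try by rewrite mem_graftingsF ?sF.
- by rewrite mem_graftingsF // orbF mem_map // mem_unpainted_enum nb_leaves1.
- by rewrite sF // (mem_graftings_by_leaves _ _ _ _ _ _ memP) nb_leaves2 -!andbA.
Qed.

Lemma card_unpainted_enum_catalan m : #|` unpainted_enum m.+1| = catalan m.
Proof.
elim/ltn_ind: m => -[|m] IHm; rewrite card_unpainted_enum.
  by rewrite big_geq.
rewrite catalan_convolution big_add1; apply: eq_big_nat => i /=.
rewrite ltnS => le_im.
by rewrite subSS subSn // !IHm // ltnS leq_subr.
Qed.

Lemma card_bij_painted_enum (T : finType) (f : T -> ptree) n :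
  set_bij [set: T] (painted_binary_trees n) f -> #|T| = #|` painted_enum n|.
Proof.
case=> imf injf surjf; rewrite cardE -(size_map f).
apply/perm_size/uniq_perm => [||t].
- rewrite map_inj_uniq ?enum_uniq // => x y.
  by apply: injf; rewrite inE.
- exact: fset_uniq.
rewrite mem_painted_enum; apply/mapP/andP => [[x _ ->]|[Pt /eqP nt]].
  by have [? ->] := imf x I.
have [|x _ <-] := surjf t; first by [].
by exists x; rewrite ?mem_enum.
Qed.

(* [J n] is the vertex set of the multiplihedron J(n), which [tree_of] puts in
   bijection with the painted binary trees with n leaves. *)
Theorem theorem3p1
  (J : nat -> finType) (tree_of : forall n : nat, J n -> ptree)
  (tree_of_bij : forall n : nat, 1 <= n ->
     set_bij [set: J n] (painted_binary_trees n) (tree_of n))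
  (a : nat -> nat) (a_0 : a 0 = 0)
  (a_vertices : forall n : nat, 1 <= n -> a n = #|J n|)
  (n : nat) (n_ge1 : 1 <= n) :
  [/\ a n = #|` fset_set (painted_binary_trees n)|,
      a n = catalan (n - 1) + \sum_(1 <= i < n) a i * a (n - i)
    & catalan (n - 1) = #|` fset_set (unpainted_binary_trees n)|].
Proof.
have aE i : 1 <= i -> a i = #|` painted_enum i|.
  move=> i_ge1; rewrite a_vertices //.
  by rewrite (card_bij_painted_enum _ _ _ (tree_of_bij i i_ge1)).
have catE : catalan (n - 1) = #|` unpainted_enum n|.
  by rewrite -card_unpainted_enum_catalan subn1 prednK.
split; [exact: aE | | exact: catE].
rewrite catE aE // card_painted_enum; congr (_ + _).
by apply: eq_big_nat => i /andP[i_ge1 lt_in]; rewrite !aE // subn_gt0.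
Qed.
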